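(* (a) On the set $\mathsf{LO}\setminus(\mathsf{LO}_r\cup\mathsf{LO}_l)$ the relations $\underline{\bowtie}_{\mathsf{LO}}$ and $\cong_{\mathsf{LO}}$ coincide, so that the restriction of $\underline{\bowtie}_{\mathsf{LO}}$ to $\mathsf{LO}\setminus(\mathsf{LO}_r\cup\mathsf{LO}_l)$ is Borel reducible to $\cong_{\mathsf{LO}}$ via the identity map. (b) Each of the restrictions of $\underline{\bowtie}_{\mathsf{LO}}$ to $\mathsf{LO}_r\cap\mathsf{LO}_l$, to $\mathsf{LO}_l\setminus\mathsf{LO}_r$, and to $\mathsf{LO}_r\setminus\mathsf{LO}_l$ is Borel reducible to $(\cong_{\mathsf{LO}})^+$, and thus to $\cong_{\mathsf{LO}}$.
   Context: $\mathsf{LO}$ is the Polish space of codes $L\in 2^{\mathbb{N}\times\mathbb{N}}$ for reflexive linear orders on $\mathbb{N}$; $\cong_{\mathsf{LO}}$ is isomorphism. $L\trianglelefteq L'$ iff there is an order embedding of $L$ into $L'$ with convex image; $L\mathrel{\underline{\bowtie}_{\mathsf{LO}}}L'$ iff $L\trianglelefteq L'$ and $L'\trianglelefteq L$ (for $L,L'\in\mathsf{LO}$). A linear order $L$ is right compressible if $L=L'+L_r$ with $L'\cong L$ and $L_r\ne\emptyset$, and left compressible if $L=L_l+L'$ with $L'\cong L$ and $L_l\neq\emptyset$ (here $+$ is ordered sum). $\mathsf{LO}_r$ and $\mathsf{LO}_l$ are the sets of right, respectively left, compressible elements of $\mathsf{LO}$. For an equivalence relation $E$ on a standard Borel space $X$,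 $A\subseteq X$ and an equivalence relation $F$ on $Y$, ''$E\restriction A$ is Borel reducible to $F$'' means there is a Borel $\varphi\colon X\to Y$ such that for all $x,y\in A$, $xEy\iff\varphi(x)F\varphi(y)$. The Friedman–Stanley jump $E^+$ is the equivalence relation on $X^{\mathbb{N}}$ given by $(x_n)E^+(y_n)$ iff $\{[x_n]_E:n\in\mathbb{N}\}=\{[y_n]_E:n\in\mathbb{N}\}$. *)

(* Defs.v *)
From mathcomp Require Import all_boot.
From mathcomp Require Import boolp classical_sets functions.
From mathcomp Require Import topology_structure bool_topology.
From mathcomp Require Import subtype_topology function_spaces.
From mathcomp Require Import measurable_structure.

Set Implicit Arguments.
Unset Strict Implicit.
Unset Printing Implicit Defensive.

Local Open Scope classical_set_scope.

(* Orders are always reflexive here (<=, not <). *)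
Definition linear_order (T : Type) (r : rel T) : Prop :=
  [/\ reflexive r, antisymmetric r, transitive r & total r].

Definition order_iso (S T : Type) (r : rel S) (s : rel T) : Prop :=
  exists2 f : S -> T, bijective f & {mono f : x y / r x y >-> s x y}.

Definition order_convex (T : Type) (r : rel T) (A : set T) : Prop :=
  forall x y z, A x -> A z -> r x y -> r y z -> A y.

(* For reflexive antisymmetric relations, [{mono f : _}] entails injectivity. *)
Definition convex_embeddable (S T : Type) (r : rel S) (s : rel T) : Prop :=
  exists2 f : S -> T,
    {mono f : x y / r x y >-> s x y} & order_convex s (range f).

Definition order_sum (S T : Type) (r : rel S) (s : rel T) : rel (S + T) :=
  fun x y => match x, y with
             | inl a, inl b => r a b
             | inl _, inr _ => true
             | inr _, inl _ => false
             | inr a, inr b => s a b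
             end.

(* The equality [L = L' + L_r] between a linear order and an ordered sum is
   equality up to isomorphism; the summands may have any carrier (in particular
   [L_r] may be finite). *)
Definition right_compressible (T : Type) (r : rel T) : Prop :=
  exists (S R : Type) (r' : rel S) (rr : rel R),
    [/\ linear_order r', linear_order rr,
        order_iso r (order_sum r' rr), order_iso r' r & inhabited R].

Definition left_compressible (T : Type) (r : rel T) : Prop :=
  exists (R S : Type) (rl : rel R) (r' : rel S),
    [/\ linear_order rl, linear_order r',
        order_iso r (order_sum rl r'), order_iso r' r & inhabited R].

(* A code [c] satisfies [c (n, m) = true] iff [n] is below or equal to [m]. *)
Definition codes : topologicalType :=
  prod_topology (fun _ : nat * nat => bool).

Definition LO_codes : set codes :=
  [set c | linear_order (fun n m : nat => c (n, m))].

(* As a [set_type], [LO] carries the topology induced from [codes]. *)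
Definition LO : topologicalType := set_type LO_codes.

Definition LO_rel (L : LO) : rel nat := fun n m => set_val L (n, m).

Definition LO_iso (L L' : LO) : Prop := order_iso (LO_rel L) (LO_rel L').

Definition LO_convex_le (L L' : LO) : Prop :=
  convex_embeddable (LO_rel L) (LO_rel L').

Definition LO_convex_biemb (L L' : LO) : Prop :=
  LO_convex_le L L' /\ LO_convex_le L' L.

Definition LO_r : set LO := [set L | right_compressible (LO_rel L)].

Definition LO_l : set LO := [set L | left_compressible (LO_rel L)].

Definition borel_map (X Y : topologicalType) (phi : X -> Y) : Prop :=
  forall B : set Y, <<s open >> B -> <<s open >> (phi @^-1` B).

(* [phi] is Borel on the whole of [X], not only on [A]. *)
Definition borel_reduction (X Y : topologicalType) (E : X -> X -> Prop)
    (A : set X) (F : Y -> Y -> Prop) (phi : X -> Y) : Prop :=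
  borel_map phi /\
  forall x y, A x -> A y -> (E x y <-> F (phi x) (phi y)).

Definition borel_reducible (X Y : topologicalType) (E : X -> X -> Prop)
    (A : set X) (F : Y -> Y -> Prop) : Prop :=
  exists phi : X -> Y, borel_reduction E A F phi.

Definition eq_class (X : Type) (E : X -> X -> Prop) (x : X) : set X :=
  [set y | E x y].

Definition sequences (X : topologicalType) : topologicalType :=
  prod_topology (fun _ : nat => X).

Definition FS_jump (X : topologicalType) (E : X -> X -> Prop)
    (x y : sequences X) : Prop :=
  range (fun n => eq_class E (x n)) = range (fun n => eq_class E (y n)).

(* Main.v *)
(* If [L = A + L + B] with [B] nonempty, then [L] is right compressible: a
   convex self-embedding can be straightened into one onto a proper initial
   segment, by a Lindenbaum (Schroeder-Bernstein) argument.  Hence convex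
   biembeddings of incompressible orders are onto, and the image of a convex
   biembedding reaches the end of its target on every incompressible side.

   On each of the three other classes, [L] is determined up to convex
   biembeddability by the set of isomorphism types of its intervals that are
   closed on the compressible sides and unbounded on the incompressible ones:
   [L] embeds in one of its own intervals.  Intervals may be finite, so they
   are coded as [omega + C], from which [C] is recovered.

   The jump of isomorphism reduces to isomorphism by sending [(L_n)] to the
   sum of [1 + L_(c i) * omega^*] over a countable dense order whose colouring
   [c] has all its colour classes dense.  By back and forth, its isomorphism
   type only depends on the set of isomorphism types of the [L_n].  Conversely
   the markers [1] are the points without immediate predecessor, and the points
   of the [L_(c i)] are those with an immediate predecessor but without
   immediate successor. *)
Require Import Defs.
From mathcomp Require Import all_boot all_order ssralg ssrnum ssrint.
From mathcomp Require Import boolp classical_sets functions cardinality filter.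
From mathcomp Require Import topology_structure bool_topology discrete_topology.
From mathcomp Require Import initial_topology supremum_topology.
From mathcomp Require Import subtype_topology function_spaces.
From mathcomp Require Import measurable_structure.

Set Implicit Arguments.
Unset Strict Implicit.
Unset Printing Implicit Defensive.

Local Open Scope classical_set_scope.

Import Order.TTheory GRing.Theory Num.Theory.

(** * Convex self-embeddings and compressibility *)

Section Orders.

Variables (S T : Type) (r : rel S) (s : rel T).

(** Reflexivity and antisymmetry make the choice functions of [P] in the two directions mutually
    inverse. Isomorphisms can thus be given as relations, such as those that back and forth
    produces. *)
Lemma order_iso_functional (P : S -> T -> Prop) :
  linear_order r -> linear_order s ->
  (forall x, exists y, P x y) -> (forall y, exists x, P x y) ->
  (forall x y x' y', P x x' -> P y y' -> s x' y' = r x y) ->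
  order_iso r s.
Proof.
move=> [rr ra _ _] [sr sa _ _] Pex Psurj Pmono.
have [f fP] := choice Pex; have [g gP] := choice Psurj.
exists f => [|x y]; last exact: Pmono.
exists g => [x|y].
  apply: ra; have [fx gfx] := (fP x, gP (f x)).
  by rewrite -(Pmono _ _ _ _ fx gfx) -(Pmono _ _ _ _ gfx fx) sr.
apply: sa; have [gy fgy] := (gP y, fP (g y)).
by rewrite (Pmono _ _ _ _ gy fgy) (Pmono _ _ _ _ fgy gy) !rr.
Qed.

Lemma order_iso_sym : order_iso r s -> order_iso s r.
Proof.
move=> [f [g fK gK] fm]; exists g; first by exists f.
by move=> x y; rewrite -fm !gK.
Qed.

Lemma order_iso_embed : order_iso r s -> convex_embeddable r s.
Proof.
move=> [f [g _ gK] fm]; exists f => // x y z _ _ _ _; exists (g y) => //.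
Qed.

End Orders.

Lemma order_iso_refl (T : Type) (r : rel T) : order_iso r r.
Proof. by exists id => //; exists id. Qed.

Lemma order_iso_trans (S T U : Type) (r : rel S) (s : rel T) (t : rel U) :
  order_iso r s -> order_iso s t -> order_iso r t.
Proof.
move=> [f fb fm] [g gb gm]; exists (g \o f); first exact: bij_comp.
by move=> x y /=; rewrite gm fm.
Qed.

Lemma convex_embedding_comp (S T U : Type) (r : rel S) (s : rel T) (t : rel U)
    (f : S -> T) (g : T -> U) :
  {mono f : x y / r x y >-> s x y} -> order_convex s (range f) ->
  {mono g : x y / s x y >-> t x y} -> order_convex t (range g) ->
  {mono g \o f : x y / r x y >-> t x y} /\ order_convex t (range (g \o f)).
Proof.
move=> fm fc gm gc; split=> [x y|_ y _ [x _ <-] [z _ <-]] /=.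
  by rewrite gm fm.
move=> xy yz; have [w _ ew] : range g y.
  by apply: gc xy yz; [exists (f x)|exists (f z)].
move: xy yz; rewrite -ew !gm => xw wz.
have [v _ ev] : range f w by apply: fc xw wz; [exists x|exists z].
by exists v; rewrite //= ev.
Qed.

Definition opp_rel (T : Type) (r : rel T) : rel T := fun x y => r y x.

Lemma linear_order_opp (T : Type) (r : rel T) :
  linear_order r -> linear_order (opp_rel r).
Proof.
move=> [rr ra rt rto]; split=> [x|x y|y x z|x y]; rewrite /opp_rel //.
- by rewrite andbC; exact: ra.
- by move=> ? ?; exact: (rt y).
Qed.

Lemma order_convex_opp (T : Type) (r : rel T) (A : set T) :
  order_convex r A -> order_convex (opp_rel r) A.
Proof. by move=> cA x y z Ax Az xy yz; apply: (cA z y x). Qed.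

Definition initial_self_embedding (T : Type) (r : rel T) (h : T -> T) (b : T) :=
  [/\ {mono h : x y / r x y}, forall y z, r z (h y) -> range h z & ~ range h b].

(** The embedding onto the first summand misses the second one. Conversely, [T] itself serves as
    first summand and the complement of the range of [h] as second. *)
Lemma right_compressibleP (T : Type) (r : rel T) : linear_order r ->
  right_compressible r <-> exists h b, initial_self_embedding r h b.
Proof.
move=> lr; have [rr ra rt rto] := lr; split.
  move=> [S [R [s [t [ls lt [f [g fK gK] fm] [k [l kK lK] km] [b]]]]]].
  have gm x y : r (g x) (g y) = order_sum s t x y by rewrite -fm !gK.
  have lm x y : s (l x) (l y) = r x y by rewrite -km !lK.
  exists (fun x => g (inl (l x))), (g (inr b)); split.
  - by move=> x y; rewrite gm /= lm.
  - move=> y z; rewrite -[z]fK gm; case: (f z) => [c|//] _.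
    by exists (k c); rewrite // kK.
  - by move=> [x _ /(can_inj gK)].
move=> [h [b [hm hi hb]]].
pose R := {x : T | x \in ~` range h}.
pose t : rel R := fun x y => r (val x) (val y).
pose F (u : T + R) := match u with inl x => h x | inr y => val y end.
have lt : linear_order t.
  split=> [x|x y /ra/val_inj //|y x z|x y]; rewrite /t //; first exact: rt.
have nh (x : R) : ~ range h (val x) by exact: set_mem (valP x).
have hinj : injective h.
  by move=> x y hxy; apply: ra; rewrite -hm hxy rr -hm hxy rr.
have Fm : {mono F : x y / order_sum r t x y >-> r x y}.
  move=> [x|x] [y|y] //=; apply/idP => //; first 1 last.
    by move=> /hi; exact: nh.
  by have /orP[//|/hi/nh] := rto (h x) (val y).
exists T, R, r, t; split => //; last by constructor; exists b; exact: mem_set.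
  apply: order_iso_sym.
  apply: (order_iso_functional (P := fun x y => F x = y)) => //.
  - have [tr ta tt tto] := lt.
    split=> [[x|x]|[x|x] [y|y]|[y|y] [x|x] [z|z]|[x|x] [y|y]] //=.
    + by move/ra ->.
    + by move/ta ->.
    + exact: rt.
    + exact: tt.
  - by move=> x; exists (F x).
  - move=> y; have [[x _ <-]|yh] := pselect (range h y).
      by exists (inl x).
    by exists (inr (exist _ y (mem_set yh))).
  - by move=> x y _ _ <- <-.
exact: order_iso_refl.
Qed.

Lemma order_sum_opp (S T U : Type) (r : rel S) (s : rel T) (t : rel U) :
  order_iso t (order_sum r s) ->
  order_iso (opp_rel t) (order_sum (opp_rel s) (opp_rel r)).
Proof.
pose swap (A B : Type) (u : A + B) :=
  match u with inl x => inr x | inr x => inl x end.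
move=> [f fb fm]; exists (@swap S T \o f) => [|x y].
  by apply: bij_comp fb; exists (@swap T S); case.
by rewrite /opp_rel -fm /=; case: (f x) (f y) => [?|?] [].
Qed.

Lemma left_compressible_opp (T : Type) (r : rel T) :
  left_compressible r <-> right_compressible (opp_rel r).
Proof.
split=> [[R [S [t [s [lt ls rts [k kb km] iR]]]]]|
         [S [R [s [t [ls lt rst [k kb km] iR]]]]]];
  [exists S, R, (opp_rel s), (opp_rel t)|exists R, S, (opp_rel t), (opp_rel s)];
  split => //; try exact: linear_order_opp.
- exact: order_sum_opp.
- by exists k => // x y; exact: km.
- exact: (order_sum_opp rst).
- by exists k => // x y; exact: km.
Qed.

Lemma left_compressibleP (T : Type) (r : rel T) : linear_order r ->
  left_compressible r <-> exists h b, initial_self_embedding (opp_rel r) h b.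
Proof.
move=> lr; rewrite left_compressible_opp right_compressibleP //.
exact: linear_order_opp.
Qed.

(* The witness is the identity on the set [C] of points lying below some
   [f^n(T)], and [f] above [C]. *)
Lemma convex_self_embedding_compressible (T : Type) (r : rel T) (f : T -> T) b :
  linear_order r -> {mono f : x y / r x y} -> order_convex r (range f) ->
  (forall x, ~~ r b (f x)) -> exists h, initial_self_embedding r h b.
Proof.
move=> [rr ra rt rto] fm fc fb.
have nle x y : ~~ r x y -> r y x by have /orP[->|->] := rto x y.
pose C x := exists n, forall y, ~~ r (iter n f y) x.
(* The ranges of the iterates decrease, so the exponent may be taken positive. *)
have CS x : C x -> exists n, forall y, ~~ r (iter n.+1 f y) x.
  by move=> [n Cx]; exists n => y; rewrite iterSr.
have Cf x : C (f x) <-> C x.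
  split=> [/CS[n Cx]|[n Cx]]; first by exists n => y; rewrite -fm; exact: Cx.
  by exists n.+1 => y; rewrite iterS fm.
have Cdown x y : C y -> r x y -> C x.
  by move=> [n Cy] xy; exists n => z; apply: contra (Cy z) => /rt; exact.
pose h x := if `[< C x >] then x else f x.
have hC x : C x -> h x = x by rewrite /h => /asboolP ->.
have hN x : ~ C x -> h x = f x by rewrite /h; case: asboolP.
have lt_CN x y : C x -> ~ C y -> r x y /\ ~~ r y x.
  move=> Cx nCy; have ryx : ~~ r y x by apply/negP => /(Cdown _ _ Cx).
  by split=> //; exact: nle.
exists h; split.
- move=> x y; have [Cx|Cx] := pselect (C x); have [Cy|Cy] := pselect (C y).
  + by rewrite !hC.
  + rewrite hC // hN //; have [-> _] := lt_CN _ _ Cx Cy.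
    by have [-> _] := lt_CN x (f y) Cx (fun c => Cy ((Cf y).1 c)).
  + rewrite hN // hC //; have [_ /negbTE ->] := lt_CN _ _ Cy Cx.
    by have [_ /negbTE ->] := lt_CN y (f x) Cy (fun c => Cx ((Cf x).1 c)).
  + by rewrite !hN.
- move=> y z zy; have [Cz|nCz] := pselect (C z); first by exists z; rewrite ?hC.
  have nCy : ~ C y by move=> Cy; apply: nCz; apply: Cdown zy; rewrite hC.
  rewrite hN // in zy.
  (* Exponent [1] in [C]: a point outside [C] is not below the whole range of [f]. Convexity of that
     range then captures [z]. *)
  have [w rwz] : exists w, r (f w) z.
    apply: contrapT => nw; apply: nCz; exists 1 => w; apply/negP => rwz.
    by apply: nw; exists w.
  have [w' _ ew] : range f z by apply: fc rwz zy; [exists w|exists y].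
  by exists w' => //; rewrite hN // -Cf ew.
- move=> [x _]; have [Cx|nCx] := pselect (C x).
    (* The positive exponent matters here: it puts [b] below a value of [f], against [fb]. *)
    rewrite hC // => xb; have [n /(_ x)] := CS _ Cx; rewrite xb => /nle /=.
    by apply/negP.
  by rewrite hN // => fxb; have := fb x; rewrite fxb rr.
Qed.

Section ConvexSelfEmbedding.

Variables (T : Type) (r : rel T) (f : T -> T).
Hypotheses (lr : linear_order r) (fm : {mono f : x y / r x y}).
Hypothesis fc : order_convex r (range f).

Lemma convex_self_embedding_right b :
  ~ right_compressible r -> exists x, r b (f x).
Proof.
move=> nrc; apply: contrapT => nb; apply: nrc; apply/right_compressibleP => //.
have [x|h hP] := convex_self_embedding_compressible (b := b) lr fm fc.
  by apply/negP => bx; apply: nb; exists x.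
by exists h, b.
Qed.

Lemma convex_self_embedding_left b :
  ~ left_compressible r -> exists x, r (f x) b.
Proof.
move=> nlc; apply: contrapT => nb; apply: nlc; apply/left_compressibleP => //.
have fmo : {mono f : x y / opp_rel r x y} by move=> x y; rewrite /opp_rel fm.
have [x|h hP] := convex_self_embedding_compressible (b := b)
    (linear_order_opp lr) fmo (order_convex_opp fc).
  by apply/negP => bx; apply: nb; exists x.
by exists h, b.
Qed.

End ConvexSelfEmbedding.

(** * Convex biembeddings and incompressible sides *)

Section Biembedding.

Variables (S T : Type) (r : rel S) (s : rel T) (f : S -> T) (g : T -> S).
Hypotheses (lr : linear_order r) (ls : linear_order s).
Hypotheses (fm : {mono f : x y / r x y >-> s x y}).
Hypotheses (gm : {mono g : x y / s x y >-> r x y}).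
Hypotheses (fc : order_convex s (range f)) (gc : order_convex r (range g)).

(** The self-embedding [f \o g] of [s] reaches above [z], so [z] lies between two values of [f],
    whose range is convex. *)
Lemma biembedding_upward y z :
  ~ right_compressible s -> s (f y) z -> range f z.
Proof.
move=> nrc yz; have [fgm fgc] := convex_embedding_comp gm gc fm fc.
have [x zx] := convex_self_embedding_right ls fgm fgc z nrc.
by apply: fc yz zx; [exists y|exists (g x)].
Qed.

Lemma biembedding_downward y z :
  ~ left_compressible s -> s z (f y) -> range f z.
Proof.
move=> nlc zy; have [fgm fgc] := convex_embedding_comp gm gc fm fc.
have [x xz] := convex_self_embedding_left ls fgm fgc z nlc.
by apply: fc xz zy; [exists (g x)|exists y].
Qed.

Lemma biembedding_iso :
  ~ right_compressible s -> ~ left_compressible s -> order_iso r s.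
Proof.
move=> nrc nlc.
apply: (order_iso_functional (P := fun x y => f x = y) lr ls).
- by move=> x; exists (f x).
- move=> y; have [_ _ _ sto] := ls.
  (* Any value of [f] would do for the comparison; [g] supplies one from [y]. *)
  have [yy|yy] := orP (sto y (f (g y))).
    by have [x _ <-] := biembedding_downward nlc yy; exists x.
  by have [x _ <-] := biembedding_upward nrc yy; exists x.
- by move=> x y _ _ <- <-.
Qed.

End Biembedding.

(** * The space of linear orders *)

Lemma LO_linear (L : LO) : linear_order (LO_rel L).
Proof. exact: (@set_valP _ LO_codes L). Qed.

Definition code_of (r : rel nat) : codes := fun p => r p.1 p.2.

Definition LO_of (r : rel nat) (lr : linear_order r) : LO :=
  exist _ (code_of r) (@mem_set _ LO_codes (code_of r) lr).

Lemma LO_rel_of (r : rel nat) (lr : linear_order r) : LO_rel (LO_of lr) = r.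
Proof. by rewrite /LO_rel set_valE. Qed.

Lemma cvg_prod_topology (I : Type) (T : I -> topologicalType)
    (F : set_system (prod_topology T)) (f : prod_topology T) :
  Filter F -> (forall i, (fun g => g i) @ F --> f i) -> F --> f.
Proof.
move=> FF cvF; apply/cvg_sup => i A /= [_ [[U oU <-] /= Ufi]] /filterS; apply.
exact: (cvF i U (open_nbhs_nbhs (conj oU Ufi))).
Qed.

Lemma eval_near (I : Type) (T : I -> topologicalType) (i : I)
    (f : prod_topology T) (A : set (T i)) :
  nbhs (f i) A -> \forall g \near f, A (g i).
Proof.
move=> fA; have /cvg_sup/(_ i) : f --> f by apply: cvg_id.
by apply; apply: (@initial_continuous (prod_topology T) (T i) (fun g => g i)).
Qed.

(** The jump and interval reductions are shown to be Borel in this way: both are continuous. *)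
Lemma borel_map_continuous (X Y : topologicalType) (phi : X -> Y) :
  continuous phi -> borel_map phi.
Proof.
move=> cphi; apply: smallest_sub => [|B oB]; last first.
  by apply: sub_sigma_algebra; move/continuousP: cphi; apply.
have [s0 sC sU] : sigma_algebra [set: X] <<s open >>.
  exact: smallest_sigma_algebra.
split => [|B sB|F sF]; rewrite /= ?preimage_set0 //.
  by rewrite setTD preimage_setC -setTD; exact: sC.
by rewrite preimage_bigcup; exact: sU.
Qed.

Lemma LO_near (L : LO) (n m : nat) :
  \forall L' \near L, LO_rel L' n m = LO_rel L n m.
Proof.
have near_code : \forall c \near set_val L, c (n, m) = set_val L (n, m).
  exact: (@eval_near _ (fun=> bool) _ _ [set _] (discrete_set1 _)).
exact: (@initial_continuous _ codes (@set_val _ LO_codes) L _ near_code).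
Qed.

Lemma LO_continuous (X : topologicalType) (phi : X -> LO) :
  (forall n m x, \forall y \near x,
     LO_rel (phi y) n m = LO_rel (phi x) n m) ->
  continuous phi.
Proof.
move=> near_phi; apply: (@continuous_comp_initial _ X codes set_val) => x.
apply: cvg_prod_topology => -[n m] A.
rewrite nbhs_simpl /= => /nbhs_singleton Ax.
by apply: filterS (near_phi n m x) => y; exact: (eq_ind_r A Ax).
Qed.

Lemma LO_iso_biembed (L L' : LO) : LO_iso L L' -> LO_convex_biemb L L'.
Proof.
by move=> LL'; split; apply: order_iso_embed => //; exact: order_iso_sym.
Qed.

Lemma LO_incompressible_biembP (L L' : LO) :
  ([set: LO] `\` (LO_r `|` LO_l)) L -> ([set: LO] `\` (LO_r `|` LO_l)) L' ->
  (LO_convex_biemb L L' <-> LO_iso L L').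
Proof.
move=> _ [_ nL']; split; last exact: LO_iso_biembed.
move=> [[f fm fc] [g gm gc]].
apply: (biembedding_iso (LO_linear L) (LO_linear L') fm gm fc gc).
  by move=> rL'; apply: nL'; left.
by move=> lL'; apply: nL'; right.
Qed.

(** * Back and forth over a dense colouring *)

Section DenseColouring.

Variables (d : Order.disp_t) (I : orderType d) (c : I -> nat).

(** For countable nonempty [I], this is the order of the rationals with every colour class dense,
    unique up to isomorphism. *)
Definition dense_colouring :=
  [/\ forall x m, exists2 z, (x < z)%O & c z = m,
      forall x m, exists2 z, (z < x)%O & c z = m &
      forall x y m, (x < y)%O -> exists2 z, (x < z < y)%O & c z = m].

Hypothesis dc : dense_colouring.

(** [X] is replaced by one upper bound [x0] still below [Y], then [Y] by one lower bound [y0] above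
    [x0], and density applies between the two. The point [i0] starts the induction when both lists
    are empty. *)
Lemma dense_colouring_gap (i0 : I) (X Y : seq I) (m : nat) :
  (forall x y, x \in X -> y \in Y -> (x < y)%O) ->
  exists2 z, c z = m &
    (forall x, x \in X -> (x < z)%O) /\ (forall y, y \in Y -> (z < y)%O).
Proof.
have [above below between] := dc => XY.
have [x0 X0 x0Y] : exists2 x0, (forall x, x \in X -> (x <= x0)%O)
    & (forall y, y \in Y -> (x0 < y)%O).
  elim: X XY => [_|x X IH XY].
    elim: Y => [|y Y [x0 _ x0Y]]; first by exists i0.
    have [z zy _] := below y 0; exists (Order.min x0 z) => // t.
    rewrite inE gt_min => /orP[/eqP ->|/x0Y ->//]; by rewrite zy orbT.
  have [|x0 X0 x0Y] := IH.
    by move=> u v uX; apply: XY; rewrite inE uX orbT.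
  exists (Order.max x x0) => [u|y yY]; last first.
    by rewrite gt_max x0Y // XY // mem_head.
  by rewrite inE le_max => /orP[/eqP ->|/X0 ->]; rewrite ?lexx ?orbT.
have [y0 x0y0 Y0] : exists2 y0, (x0 < y0)%O
    & (forall y, y \in Y -> (y0 <= y)%O).
  elim: Y x0Y {XY} => [_|y Y IH x0Y].
    by have [z xz _] := above x0 0; exists z.
  have [|y0 xy0 Y0] := IH.
    by move=> u uY; apply: x0Y; rewrite inE uY orbT.
  exists (Order.min y y0) => [|u]; first by rewrite lt_min xy0 x0Y // mem_head.
  by rewrite inE ge_min => /orP[/eqP ->|/Y0 ->]; rewrite ?lexx ?orbT.
have [z /andP[xz zy] cz] := between x0 y0 m x0y0.
exists z => //; split=> [x /X0 /le_lt_trans|y /Y0]; first exact.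
exact: lt_le_trans.
Qed.

(** Colours are matched through [R] instead of being preserved, because the same isomorphism type
    may occur under different indices in two sequences. *)
Definition partial_iso (R : nat -> nat -> Prop) (s : seq (I * I)) :=
  (forall p, p \in s -> R (c p.1) (c p.2)) /\
  (forall p q, p \in s -> q \in s -> (p.1 < q.1)%O = (p.2 < q.2)%O).

Definition swap_pair (p : I * I) := (p.2, p.1).

Lemma partial_iso_swap R s :
  partial_iso R s -> partial_iso (fun a b => R b a) (map swap_pair s).
Proof.
move=> [sR sm]; split=> [_ /mapP[p ps ->]|_ _ /mapP[p ps ->] /mapP[q qs ->]].
  exact: sR.
by rewrite /= sm.
Qed.

Lemma partial_iso_forth (R : nat -> nat -> Prop) s a :
  (forall n, exists m, R n m) -> partial_iso R s ->
  exists b, partial_iso R ((a, b) :: s).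
Proof.
move=> Rex [sR sm].
(* If [a] is already matched, its partner is reused; otherwise a partner is found in the gap between
   the images of the points below and above [a]. *)
have [/hasP[p ps /eqP pa]|/hasPn na] := boolP (has (fun p => p.1 == a) s).
  exists p.2; have -> : (a, p.2) = p by rewrite -pa; case: (p).
  split=> [q|q t]; rewrite !inE => /orP[/eqP ->|qs]; try exact: sR.
    by move=> /orP[/eqP ->|ts]; exact: sm.
  by move=> /orP[/eqP ->|ts]; exact: sm.
have [m Rm] := Rex (c a).
pose X := [seq p.2 | p <- s & (p.1 < a)%O].
pose Y := [seq p.2 | p <- s & (a < p.1)%O].
have [|z cz [Xz zY]] := @dense_colouring_gap a X Y m.
  move=> x y /mapP[p]; rewrite mem_filter => /andP[pa ps] ->.
  move=> /mapP[q]; rewrite mem_filter => /andP[aq qs] ->.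
  by rewrite -sm //; exact: lt_trans aq.
have zP p : p \in s -> (p.1 < a)%O = (p.2 < z)%O /\ (a < p.1)%O = (z < p.2)%O.
  move=> ps; have [pa|ap|pa] := ltgtP p.1 a.
  - have pz : (p.2 < z)%O.
      by apply: Xz; apply/mapP; exists p; rewrite // mem_filter pa.
    by rewrite pz lt_gtF.
  - have zp : (z < p.2)%O.
      by apply: zY; apply/mapP; exists p; rewrite // mem_filter ap.
    by rewrite zp lt_gtF.
  - by have := na p ps; rewrite pa eqxx.
exists z; split=> [p|p q]; rewrite !inE => /orP[/eqP ->|ps]; rewrite /= ?cz //.
- exact: sR.
- by move=> /orP[/eqP ->|qs]; rewrite ?ltxx //=; have [] := zP q qs.
- by move=> /orP[/eqP ->|qs] /=; [have [] := zP p ps|exact: sm].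
Qed.

Lemma partial_iso_back (R : nat -> nat -> Prop) s b :
  (forall m, exists n, R n m) -> partial_iso R s ->
  exists a, partial_iso R ((a, b) :: s).
Proof.
move=> Rex sP; have [a aP] := partial_iso_forth b Rex (partial_iso_swap sP).
exists a; have /= := partial_iso_swap aP.
by rewrite -map_comp map_id_in => [|[]].
Qed.

Variable e : nat -> I.
Hypothesis eP : forall i, exists n, e n = i.

(** Step [n] adds [e n] to the domain and to the range of a finite partial isomorphism; [P] is the
    union of all stages. *)
Lemma back_and_forth (R : nat -> nat -> Prop) :
  (forall n, exists m, R n m) -> (forall m, exists n, R n m) ->
  exists P : I -> I -> Prop,
    [/\ forall a, exists b, P a b, forall b, exists a, P a b,
        forall a b, P a b -> R (c a) (c b) &
        forall a a' b b', P a b -> P a' b' -> (a < a')%O = (b < b')%O].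
Proof.
move=> Rf Rb.
have step (ns : nat * seq (I * I)) : exists s, partial_iso R ns.2 ->
    [/\ partial_iso R s, {subset ns.2 <= s},
        exists b, (e ns.1, b) \in s & exists a, (a, e ns.1) \in s].
  case: ns => n s /=.
  have [sP|?] := pselect (partial_iso R s); last by exists s.
  have [b sP1] := partial_iso_forth (e n) Rf sP.
  have [a sP2] := partial_iso_back (e n) Rb sP1.
  exists ((a, e n) :: (e n, b) :: s) => _; split => //.
  - by move=> p ps; rewrite !inE ps !orbT.
  - by exists b; rewrite !inE eqxx orbT.
  - by exists a; rewrite mem_head.
have [F FP] := choice step.
pose S := nat_rect (fun=> seq (I * I)) [::] (fun n s => F (n, s)).
have SP n : partial_iso R (S n).
  by elim: n => [//|n /(FP (n, S n))[]].
have Sle n k : {subset S n <= S (n + k)%N}.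
  elim: k => [|k IH] p ps; first by rewrite addn0.
  rewrite addnS; have [_ sub _ _] := FP (n + k, S (n + k)) (SP _).
  exact/sub/IH.
exists (fun a b => exists n, (a, b) \in S n); split.
- move=> a; have [n <-] := eP a; have [_ _ [b bS] _] := FP (n, S n) (SP n).
  by exists b, n.+1.
- move=> b; have [n <-] := eP b; have [_ _ _ [a aS]] := FP (n, S n) (SP n).
  by exists a, n.+1.
- by move=> a b [n /(SP n).1].
- move=> a a' b b' [n abn] [n' abn'].
  (* Both pairs already belong to the common stage [n + n']. *)
  have [_ mono] := SP (n + n').
  by apply: (mono (a, b) (a', b')); last rewrite addnC; exact: Sle.
Qed.

End DenseColouring.


(* Nonempty integer words, as the empty word would be a least element.  The
   colour of a point is given by its last letter, which can be freely appended:
   the words [w ++ (a - 1) :: u] lie between [w] and [w ++ a :: v]. *)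
Definition dense_index := (int *l seqlexi int)%type.

(** One-letter words get colour [0] by default. *)
Definition colour (i : dense_index) : nat := absz (last 0%R (i.2 : seq int)).

Lemma seqlexi_between (u v : seqlexi int) (m : nat) : (u < v)%O ->
  exists2 w : seqlexi int, (u < w < v)%O & absz (last 0%R (w : seq int)) = m.
Proof.
(* The last letter is reserved for the colour; only the prefix [w] remains to be found. *)
suff H : (u < v)%O -> exists w : seq int,
    (u < (rcons w (m%:Z)%R : seqlexi int) < v)%O.
  by move=> /H[w wP]; exists (rcons w (m%:Z)%R) => //; rewrite last_rcons.
elim: u v => [|a u IH] [|b v] //=.
  move=> _; exists [:: b - 1]%R.
  by rewrite ltxi_cons ltW ?ltrBlDr ?ltrDl //= lt_geF // ltrBlDr ltrDl.
rewrite ltxi_cons => /andP[]; rewrite le_eqVlt => /orP[/eqP <-|ab _].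
  rewrite lexx => /IH[w wP]; exists (a :: w).
  by rewrite /= !ltxi_cons lexx.
exists (a :: u); rewrite /= !ltxi_cons lexx (ltW ab) /= (lt_geF ab) andbT.
by elim: u {IH} => [//|x u IH]; rewrite /= ltxi_cons lexx.
Qed.

Lemma dense_colouring_index : dense_colouring colour.
Proof.
split=> [[a u] m|[a u] m|[a u] [b v] m].
- exists (a + 1, [:: m%:Z] : seqlexi int)%R => //.
  by rewrite ltxi_pair /= lerDl ler01 /= lt_geF // ltrDl.
- exists (a - 1, [:: m%:Z] : seqlexi int)%R => //.
  by rewrite ltxi_pair /= gerBl ler01 /= lt_geF // ltrBlDr ltrDl.
rewrite ltxi_pair /= => /andP[]; rewrite le_eqVlt => /orP[/eqP <-|ab _].
  rewrite lexx => /(@seqlexi_between _ _ m)[w /andP[uw wv] wm].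
  exists (a, w) => //.
  by rewrite !ltxi_pair /= lexx /= uw wv.
exists (a, rcons u (m%:Z)%R); last by rewrite /colour /= last_rcons.
rewrite !ltxi_pair /= lexx (ltW ab) (lt_geF ab) /= andbT.
by elim: u => [//|x u IH]; rewrite /= ltxi_cons lexx.
Qed.

Lemma colour_surj (n : nat) : exists i, colour i = n.
Proof.
have [above _ _] := dense_colouring_index.
by have [z _ <-] := above (0%R, [::]) n; exists z.
Qed.

(** * Shuffles *)

(** This is the ordered sum of the [s i] along [r]; for constant [s], it replaces each point of [r]
    by a copy of [s]. *)
Definition lex_rel (I : eqType) (J : Type) (r : rel I) (s : I -> rel J) :
    rel (I * J) :=
  fun p q => if p.1 == q.1 then s p.1 p.2 q.2 else r p.1 q.1.

Lemma lex_rel_linear (I : eqType) (J : Type) (r : rel I) (s : I -> rel J) :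
  linear_order r -> (forall i, linear_order (s i)) ->
  linear_order (lex_rel r s).
Proof.
move=> [rr ra rt rto] ls; split.
- by move=> [i a]; rewrite /lex_rel /= eqxx; have [-> //] := ls i.
- move=> [i a] [j b]; rewrite /lex_rel /= [j == i]eq_sym.
  case: eqVneq => [<-|ij /ra /eqP]; last by rewrite (negbTE ij).
  by have [_ sa _ _] := ls i; move/sa ->.
- move=> [j b] [i a] [k c]; rewrite /lex_rel /=.
  have [<-{j}|ij] := eqVneq i j.
    by case: eqVneq => // _; have [_ _ st _] := ls i; exact: st.
  have [<-{k}|jk] := eqVneq j k; first by rewrite (negbTE ij).
  have [<-|_] := eqVneq i k; last exact: rt.
  by move=> rij rji; case/eqP: ij; apply: ra; rewrite rij rji.
- move=> [i a] [j b]; rewrite /lex_rel /= [j == i]eq_sym.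
  by case: eqVneq => [<-|//]; have [_ _ _] := ls i; exact.
Qed.

Definition with_bottom (J : Type) (s : rel J) : rel (option J) :=
  fun a b => match a, b with
             | None, _ => true
             | Some _, None => false
             | Some x, Some y => s x y
             end.

Lemma with_bottom_linear (J : Type) (s : rel J) :
  linear_order s -> linear_order (with_bottom s).
Proof.
move=> [sr sa st sto]; split=> [[]|[x|] [y|]|[y|] [x|] [z|]|[x|] [y|]] //=.
- by move/sa ->.
- exact: st.
Qed.

Definition omega_opp : rel nat := fun m n => n <= m.

Lemma omega_opp_linear : linear_order omega_opp.
Proof.
split=> [x|x y|y x z xy yz|x y]; rewrite /omega_opp //.
- by rewrite andbC => /anti_leq.
- exact: leq_trans yz xy.
- exact: leq_total.
Qed.

(* In block [i], [None] is the marker and [Some (x, k)] is the [k]-th point from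
   the right in the copy of [omega^*] replacing [x]. *)
Definition shuffle_type := (dense_index * option (nat * nat))%type.

Definition shuffle (M : nat -> rel nat) : rel shuffle_type :=
  lex_rel <=%O
    (fun i => with_bottom (lex_rel (M (colour i)) (fun=> omega_opp))).

Lemma shuffle_linear (M : nat -> rel nat) :
  (forall n, linear_order (M n)) -> linear_order (shuffle M).
Proof.
move=> lM; apply: lex_rel_linear => [|i].
  split; [exact: lexx|exact: le_anti|exact: le_trans|exact: le_total].
apply/with_bottom_linear/lex_rel_linear => // _; exact: omega_opp_linear.
Qed.

(** * Immediate predecessors and successors in shuffles *)

Definition covers (T : Type) (r : rel T) (x y : T) :=
  ~~ r y x /\ forall z, r z x || r y z.

Lemma covers_iso (S T : Type) (r : rel S) (s : rel T) (f : S -> T) :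
  bijective f -> {mono f : x y / r x y >-> s x y} ->
  forall x y, covers s (f x) (f y) <-> covers r x y.
Proof.
move=> [g fK gK] fm x y.
split=> [[yx nz]|[yx nz]]; split; rewrite -?fm // ?fm //.
  by move=> z; rewrite -!fm.
by move=> z; rewrite -[z]gK !fm.
Qed.

Definition has_predecessor (T : Type) (r : rel T) y := exists x, covers r x y.
Definition has_successor (T : Type) (r : rel T) x := exists y, covers r x y.

Lemma has_predecessor_iso (S T : Type) (r : rel S) (s : rel T) (f : S -> T) :
  bijective f -> {mono f : x y / r x y >-> s x y} ->
  forall x, has_predecessor s (f x) <-> has_predecessor r x.
Proof.
move=> fb fm x; have [g fK gK] := fb; split=> [[y]|[y yx]].
  by rewrite -[y]gK covers_iso // => yx; exists (g y).
by exists (f y); apply/covers_iso.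
Qed.

Lemma has_successor_iso (S T : Type) (r : rel S) (s : rel T) (f : S -> T) :
  bijective f -> {mono f : x y / r x y >-> s x y} ->
  forall x, has_successor s (f x) <-> has_successor r x.
Proof.
move=> fb fm x; have [g fK gK] := fb; split=> [[y]|[y yx]].
  by rewrite -[y]gK covers_iso // => yx; exists (g y).
by exists (f y); apply/covers_iso.
Qed.

Section Shuffle.

Variable M : nat -> rel nat.
Hypothesis lM : forall n, linear_order (M n).

Let between (i j : dense_index) : (i < j)%O -> exists2 k, (i < k)%O & (k < j)%O.
Proof.
have [_ _ bt] := dense_colouring_index => ij.
by have [k /andP[ik kj] _] := bt i j 0 ij; exists k.
Qed.

Lemma shuffle_lt (p q : shuffle_type) : (p.1 < q.1)%O -> shuffle M p q.
Proof. by move=> pq; rewrite /shuffle /lex_rel lt_eqF // ltW. Qed.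

Lemma shuffle_gt (p q : shuffle_type) : (p.1 < q.1)%O -> shuffle M q p = false.
Proof. by move=> pq; rewrite /shuffle /lex_rel gt_eqF // lt_geF. Qed.

Lemma shuffle_index (p q : shuffle_type) : shuffle M p q -> (p.1 <= q.1)%O.
Proof. by rewrite /shuffle /lex_rel; case: eqVneq => [->|]. Qed.

Lemma shuffle_covers i x k :
  covers (shuffle M) (i, Some (x, k.+1)) (i, Some (x, k)).
Proof.
have [_ _ _ Mto] := lM (colour i).
split=> [|[j b]]; rewrite /shuffle /lex_rel /= ?eqxx /=.
  by rewrite /omega_opp ltnn.
have [->|ne] := eqVneq j i; last by rewrite le_total.
case: b => [[y l]|] //=.
have [_|_] := eqVneq y x; first by rewrite /omega_opp leqNgt ltnS orNb.
exact: Mto.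
Qed.

(** A marker is the least point of its block, and by density another block lies between it and any
    point of an earlier block. *)
Lemma shuffle_has_predecessor i a :
  has_predecessor (shuffle M) (i, a) <-> a != None.
Proof.
split=> [[[j b] [nle cov]]|]; last first.
  by case: a => // -[x k] _; exists (i, Some (x, k.+1)); exact: shuffle_covers.
case: a nle cov => // nle cov.
have ji : (j < i)%O.
  rewrite lt_neqAle; apply/andP; split; apply: contraNT nle;
    rewrite /shuffle /lex_rel /=.
    by move/negbNE/eqP ->; rewrite eqxx.
  by rewrite -ltNge => ij; rewrite lt_eqF // ltW.
have [k jk ki] := between ji.
by have := cov (k, None); rewrite !shuffle_gt.
Qed.

Lemma shuffle_has_successor i x k :
  has_successor (shuffle M) (i, Some (x, k)) <-> k != 0.
Proof.
split=> [[[j b] [nle cov]]|]; last first.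
  by case: k => // k _; exists (i, Some (x, k)); exact: shuffle_covers.
apply/negP => /eqP k0; rewrite {k}k0 in nle cov.
have [ij|ji] := eqVneq i j; last first.
  have ij : (i < j)%O.
    rewrite lt_neqAle ji leNgt; apply: contra nle => ji'; exact: shuffle_lt.
  have [k ik kj] := between ij.
  by have := cov (k, None); rewrite !shuffle_gt.
rewrite -{j}ij in nle cov.
case: b nle cov => [[y l]|]; rewrite /shuffle /lex_rel /= eqxx //=.
have [_|yx nle] := eqVneq y x; first by rewrite /omega_opp leq0n.
(* The copy of [omega^*] at [y] has no least point: position [l.+1] precedes position [l]. *)
move=> /(_ (i, Some (y, l.+1))); rewrite /= !eqxx /= (negbTE yx) (negbTE nle).
by rewrite /omega_opp ltnn.
Qed.

End Shuffle.

(** * Isomorphisms between shuffles *)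

Section ShuffleIso.

Variables (M M' : nat -> rel nat) (f : shuffle_type -> shuffle_type).
Hypotheses (lM : forall n, linear_order (M n)).
Hypotheses (lM' : forall n, linear_order (M' n)).
Hypotheses (fb : bijective f).
Hypothesis fm : {mono f : p q / shuffle M p q >-> shuffle M' p q}.

Lemma shuffle_iso_None i : (f (i, None)).2 = None.
Proof.
case E : (f _) => [j [b|]] //=.
have : has_predecessor (shuffle M') (f (i, None)).
  by rewrite E; apply/shuffle_has_predecessor.
by rewrite (has_predecessor_iso fb fm) shuffle_has_predecessor.
Qed.

Lemma shuffle_iso_Some i x : exists y, (f (i, Some (x, 0))).2 = Some (y, 0).
Proof.
case E : (f _) => [j [[y l]|]] /=; last first.
  have : has_predecessor (shuffle M) (i, Some (x, 0)).
    exact/shuffle_has_predecessor.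
  by rewrite -(has_predecessor_iso fb fm) E shuffle_has_predecessor.
exists y; case: l E => // l E.
have : has_successor (shuffle M') (f (i, Some (x, 0))).
  by rewrite E; apply/shuffle_has_successor.
by rewrite (has_successor_iso fb fm) shuffle_has_successor.
Qed.

End ShuffleIso.

(* Isomorphisms preserve markers, and a point above the marker of block [i] is
   in that block if and only if no other marker separates the two. *)
Lemma shuffle_iso_block (M M' : nat -> rel nat)
    (f g : shuffle_type -> shuffle_type) :
  (forall n, linear_order (M n)) -> (forall n, linear_order (M' n)) ->
  cancel f g -> cancel g f ->
  {mono f : p q / shuffle M p q >-> shuffle M' p q} ->
  forall i a, (f (i, Some a)).1 = (f (i, None)).1.
Proof.
move=> lM lM' fK gK fm i a.
have gm : {mono g : p q / shuffle M' p q >-> shuffle M p q}.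
  by move=> p q; rewrite -fm !gK.
have fb : bijective f by exists g.
have gb : bijective g by exists f.
have := shuffle_iso_None lM lM' fb fm i.
case Ei : (f (i, None)) => [i' o] /= o0; rewrite {o}o0 in Ei.
case Ea : (f (i, Some a)) => [j b] /=.
have ij : (i' <= j)%O.
  have := @shuffle_index M' (f (i, None)) (f (i, Some a)).
  by rewrite fm Ei Ea; apply; rewrite /shuffle /lex_rel /= eqxx.
apply/eqP; rewrite eq_sym; move: ij; rewrite le_eqVlt => /orP[//|ij].
(* If block [j] came after block [i'], its marker would pull back to a marker strictly above that of
   block [i] but below [(i, Some a)], and there is none. *)
have := shuffle_iso_None lM' lM gb gm j.
case Ej : (g (j, None)) => [k o] /= o0; rewrite {o}o0 in Ej.
have fk : f (k, None) = (j, None) by rewrite -Ej gK.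
have ki : shuffle M (k, None) (i, Some a).
  by rewrite -fm fk Ea /shuffle /lex_rel /= eqxx.
have ik : shuffle M (k, None) (i, None) = false.
  by rewrite -fm fk Ei shuffle_gt.
have := shuffle_index ki; rewrite /= le_eqVlt => /orP[/eqP ek|ltki]; last first.
  by rewrite shuffle_lt in ik.
by rewrite ek /shuffle /lex_rel /= eqxx in ik.
Qed.

(** A block of colour [n] goes to a single block, and its points at position [0], which form a copy
    of [M n], go onto those of the image block. *)
Lemma shuffle_iso_summand (M M' : nat -> rel nat) :
  (forall n, linear_order (M n)) -> (forall n, linear_order (M' n)) ->
  order_iso (shuffle M) (shuffle M') ->
  forall n, exists m, order_iso (M n) (M' m).
Proof.
move=> lM lM' [f [g fK gK] fm] n.
have gm : {mono g : p q / shuffle M' p q >-> shuffle M p q}.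
  by move=> p q; rewrite -fm !gK.
have fb : bijective f by exists g.
have gb : bijective g by exists f.
have [i ci] := colour_surj n.
have := shuffle_iso_None lM lM' fb fm i.
case Ei : (f (i, None)) => [i' o] /= o0; rewrite {o}o0 in Ei.
have gi : g (i', None) = (i, None) by rewrite -Ei fK.
exists (colour i'); rewrite -ci.
apply: (order_iso_functional (P := fun x y =>
  f (i, Some (x, 0)) = (i', Some (y, 0)))) => //.
- move=> x; have [y ey] := shuffle_iso_Some lM lM' fb fm i x; exists y.
  by rewrite [LHS]surjective_pairing ey (shuffle_iso_block lM lM' fK gK fm) Ei.
- move=> y; have [x ex] := shuffle_iso_Some lM' lM gb gm i' y; exists x.
  apply: (can_inj gK); rewrite fK [RHS]surjective_pairing ex.
  by rewrite (shuffle_iso_block lM' lM gK fK gm) gi.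
- move=> x y x' y' fx fy.
  have [Mr _ _ _] := lM (colour i); have [Mr' _ _ _] := lM' (colour i').
  have := fm (i, Some (x, 0)) (i, Some (y, 0)); rewrite fx fy.
  rewrite /shuffle /lex_rel /= !eqxx /= /omega_opp.
  (* For equal points, [lex_rel] compares position [0] with itself, which agrees with reflexivity of
     the summand. *)
  case: (eqVneq x y) => [->|_]; case: (eqVneq x' y') => [->|_];
    by rewrite ?Mr ?Mr'.
Qed.

(** Back and forth, with isomorphism of summands as [R], matches the blocks. Within matched blocks a
    chosen isomorphism of summands acts, keeping positions in [omega^*]. *)
Lemma shuffle_iso (M M' : nat -> rel nat) (e : nat -> dense_index) :
  (forall n, linear_order (M n)) -> (forall n, linear_order (M' n)) ->
  (forall i, exists n, e n = i) ->
  (forall n, exists m, order_iso (M n) (M' m)) ->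
  (forall m, exists n, order_iso (M n) (M' m)) ->
  order_iso (shuffle M) (shuffle M').
Proof.
move=> lM lM' eP MM' M'M.
have [P [Pf Pb PR Pm]] := back_and_forth dense_colouring_index eP MM' M'M.
have /choice[H HP] (nm : nat * nat) : exists h : nat -> nat,
    order_iso (M nm.1) (M' nm.2) ->
    bijective h /\ {mono h : x y / M nm.1 x y >-> M' nm.2 x y}.
  have [[h hb hm]|?] := pselect (order_iso (M nm.1) (M' nm.2)).
    by exists h.
  by exists id.
pose h i j := H (colour i, colour j).
have hP i j : P i j -> bijective (h i j) /\
    {mono h i j : x y / M (colour i) x y >-> M' (colour j) x y}.
  by move=> /PR; exact: (HP (colour i, colour j)).
apply: (order_iso_functional (P := fun p q =>
  P p.1 q.1 /\ q.2 = omap (fun xk => (h p.1 q.1 xk.1, xk.2)) p.2)).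
- exact: shuffle_linear.
- exact: shuffle_linear.
- move=> [i a]; have [j ij] := Pf i.
  by exists (j, omap (fun xk => (h i j xk.1, xk.2)) a).
- move=> [j b]; have [i ij] := Pb j; have [[g hK gK] _] := hP _ _ ij.
  exists (i, omap (fun xk => (g xk.1, xk.2)) b); split=> //.
  by case: b => [[y k]|] //=; rewrite gK.
- move=> [i a] [i2 a2] [j b] [j2 b2] /= [ij ->] [ij2 ->].
  (* Strict monotonicity makes [P] functional and injective. *)
  have eqij : (j == j2) = (i == i2).
    by rewrite !eq_le !leNgt (Pm _ _ _ _ ij ij2) (Pm _ _ _ _ ij2 ij).
  rewrite /shuffle /lex_rel /= eqij; case: eqVneq => [ii|_]; last first.
    by rewrite !leNgt (Pm _ _ _ _ ij2 ij).
  move: eqij; rewrite ii eqxx => /eqP jj; rewrite -{i2}ii -{j2}jj in ij2 *.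
  have [hb hm] := hP _ _ ij; case: a a2 => [[x k]|] [[y l]|] //=.
  by rewrite (inj_eq (bij_inj hb)) hm.
Qed.

Lemma infinite_countType_enum (T : countType) (u : nat -> T) :
  injective u -> exists e : nat -> T, bijective e.
Proof.
move=> uinj; have : ([set: T] #= [set: nat])%card.
  apply: eq_card_nat; first exact: countableP.
  move=> /(sub_finite_set (@subsetT _ (range u))).
  by rewrite (eq_finite_set (inj_card_eq (in2W uinj))); exact: infinite_nat.
move=> /card_set_bijP[f [_ finj fsurj]].
have /choice[g gP] n : exists x, f x = n.
  by have [x _ <-] := fsurj n I; exists x.
by exists g, f => // x; apply: finj; rewrite ?inE ?gP.
Qed.

(** This moves shuffles to the carrier [nat], where they become elements of [LO]. *)
Lemma shuffle_enum : exists e : nat -> shuffle_type, bijective e.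
Proof.
apply: (@infinite_countType_enum ((int * seq int) * option (nat * nat))%type
  (fun n => ((0%R, [::]), Some (n, 0)))).
by move=> n m [].
Qed.

(** * The jump of isomorphism *)

Lemma borel_reducible_comp (X Y Z : topologicalType) (E : X -> X -> Prop)
    (A : set X) (F : Y -> Y -> Prop) (G : Z -> Z -> Prop) :
  borel_reducible E A F -> borel_reducible F setT G -> borel_reducible E A G.
Proof.
move=> [phi [bphi phiP]] [psi [bpsi psiP]]; exists (psi \o phi); split.
  by move=> B /bpsi /bphi.
by move=> x y Ax Ay; rewrite phiP // psiP.
Qed.

Lemma FS_jump_LO_iso (x y : sequences LO) :
  FS_jump LO_iso x y <->
  (forall n, exists m, LO_iso (x n) (y m)) /\
  (forall m, exists n, LO_iso (x n) (y m)).
Proof.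
have class_eq (L L' : LO) :
    eq_class LO_iso L = eq_class LO_iso L' <-> LO_iso L L'.
  split=> [/(congr1 (@^~ L'))|LL'].
    by rewrite /eq_class /= => ->; exact: order_iso_refl.
  apply/seteqP; split=> K /=; first exact/order_iso_trans/order_iso_sym.
  exact: order_iso_trans.
split=> [xy|[xy yx]].
  split=> n.
    have [m _ e] :
        range (fun k => eq_class LO_iso (y k)) (eq_class LO_iso (x n)).
      by rewrite -xy; exists n.
    by exists m; apply/class_eq.
  have [m _ e] : range (fun k => eq_class LO_iso (x k)) (eq_class LO_iso (y n)).
    by rewrite xy; exists n.
  by exists m; apply/class_eq.
apply/seteqP; split=> _ [n _ <-] /=.
  by have [m xm] := xy n; exists m => //; apply/esym/class_eq.
by have [m xm] := yx n; exists m => //; apply/class_eq.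
Qed.

Lemma FS_jump_reducible :
  borel_reducible (FS_jump LO_iso) [set: sequences LO] LO_iso.
Proof.
have [e [e' eK e'K]] := shuffle_enum.
pose M (x : sequences LO) n := LO_rel (x n).
have lM x n : linear_order (M x n) by exact: LO_linear.
pose S x : rel nat := fun p q => shuffle (M x) (e p) (e q).
have Siso x : order_iso (S x) (shuffle (M x)) by exists e => //; exists e'.
have lS x : linear_order (S x).
  have [sr sa st sto] := shuffle_linear (lM x).
  split=> [p|p q /sa /(can_inj eK)|q p s|p q] //.
  - exact: sr.
  - exact: st.
  - exact: sto.
exists (fun x => LO_of (lS x)); split.
  apply: borel_map_continuous; apply: LO_continuous => p q x.
  have nearM n k l : \forall y \near x, M y n k l = M x n k l.
    exact: (@eval_near _ (fun=> LO) n x _ (LO_near (x n) k l)).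
  (* The bit at [(p, q)] depends on at most one bit [(k, l)] of one term of [x]. The default [0]
     serves for markers, whose comparisons do not depend on [x]. *)
  pose k := if (e p).2 is Some a then a.1 else 0.
  pose l := if (e q).2 is Some a then a.1 else 0.
  apply: filterS (nearM (colour (e p).1) k l) => y.
  rewrite !LO_rel_of /S /shuffle /lex_rel /k /l; case: eqP => // _.
  by case: (e p).2 (e q).2 => [a|] [b|] //= ->.
move=> x y _ _; rewrite FS_jump_LO_iso /LO_iso !LO_rel_of.
split=> [[xy yx]|Sxy].
  apply: order_iso_trans (Siso x) (order_iso_trans _ (order_iso_sym (Siso y))).
  apply: (shuffle_iso (e := fun n => (e n).1)) => // i.
  by exists (e' (i, None)); rewrite e'K.
have shxy : order_iso (shuffle (M x)) (shuffle (M y)).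
  apply: order_iso_trans (order_iso_trans Sxy (Siso y)).
  exact/order_iso_sym/Siso.
split; first exact: shuffle_iso_summand shxy.
move=> m.
have [n yx] := shuffle_iso_summand (lM y) (lM x) (order_iso_sym shxy) m.
by exists n; exact: order_iso_sym.
Qed.

(** * Intervals *)

Definition padded (C : pred nat) (k : nat) := odd k && C k./2.

(* The order [omega + C] on the carrier [nat]: the odd number [2 n + 1] stands
   for [n] when [n] is in [C]; all other numbers form the copy of [omega]. *)
Definition pad (r : rel nat) (C : pred nat) : rel nat := fun x y =>
  if padded C x then padded C y && r x./2 y./2 else padded C y || (x <= y).

Lemma padded_odd (C : pred nat) n : padded C n.*2.+1 = C n.
Proof. by rewrite /padded /= odd_double uphalf_double. Qed.

Lemma padded_double (C : pred nat) n : padded C n.*2 = false.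
Proof. by rewrite /padded odd_double. Qed.

Lemma paddedE (C : pred nat) x : padded C x -> x = x./2.*2.+1.
Proof. by move=> /andP[xo _]; rewrite -[LHS]odd_double_half xo. Qed.

Lemma pad_linear (r : rel nat) (C : pred nat) :
  linear_order r -> linear_order (pad r C).
Proof.
move=> [rr ra rt rto]; split.
- by move=> x; rewrite /pad; case: (padded C x); rewrite ?rr ?leqnn.
- move=> x y; rewrite /pad.
  case Cx: (padded C x); case Cy: (padded C y) => //=; last exact: anti_leq.
  by move=> /ra e; rewrite (paddedE Cx) (paddedE Cy) e.
- move=> y x z; rewrite /pad.
  case: (padded C x); case: (padded C y); case: (padded C z) => //=.
    exact: rt.
  exact: leq_trans.
- move=> x y; rewrite /pad.
  by case: (padded C x); case: (padded C y) => //=; exact: leq_total.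
Qed.

(** For [x] not padded, this is its position in the copy of [omega]. *)
Definition pad_rank (C : pred nat) (x : nat) :=
  count (fun k => ~~ padded C k) (iota 0 x).

Lemma pad_rankS C x : pad_rank C x.+1 = pad_rank C x + ~~ padded C x.
Proof. by rewrite /pad_rank -addn1 iotaD count_cat /= addn0. Qed.

Lemma pad_rank_le C x y : x <= y -> pad_rank C x <= pad_rank C y.
Proof.
by move=> /subnKC <-; rewrite /pad_rank iotaD count_cat leq_addr.
Qed.

Lemma pad_rank_mono C x y : ~~ padded C x -> ~~ padded C y ->
  (pad_rank C x <= pad_rank C y) = (x <= y).
Proof.
move=> Cx Cy; apply/idP/idP; last exact: pad_rank_le.
apply: contraLR; rewrite -!ltnNge => yx.
by apply: leq_trans (pad_rank_le C yx); rewrite pad_rankS Cy addn1.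
Qed.

(** Even numbers are never padded, so ranks are unbounded; they grow by at most one at a time, and
    only past a number that is not padded. *)
Lemma pad_rank_surj C k : exists2 x, ~~ padded C x & pad_rank C x = k.
Proof.
have unbounded n : n <= pad_rank C n.*2.
  elim: n => // n IH; rewrite doubleS !pad_rankS padded_double addn1.
  by rewrite (leq_trans _ (leq_addr _ _)).
have ex : exists n, k < pad_rank C n by exists k.+1.*2; exact: unbounded.
case: (ex_minnP ex) => -[//|m] km mmin.
have mk : pad_rank C m <= k.
  by rewrite leqNgt; apply/negP => /mmin; rewrite ltnn.
move: km; rewrite pad_rankS; case: (boolP (padded C m)) => Cm.
  by rewrite addn0 ltnNge mk.
by rewrite addn1 ltnS => km; exists m => //; apply/eqP; rewrite eqn_leq mk.
Qed.

(** Padded points are matched by [f], the others by their rank in the copies of [omega]. *)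
Lemma pad_iso (r r' : rel nat) (C C' : pred nat) (f : nat -> nat) :
  linear_order r -> linear_order r' ->
  {mono f : x y / r x y >-> r' x y} -> (forall n, C' (f n) = C n) ->
  (forall m, C' m -> range f m) -> order_iso (pad r C) (pad r' C').
Proof.
move=> lr lr' fm CC' fC'.
apply: (order_iso_functional (P := fun x y =>
    if padded C x then padded C' y /\ y./2 = f x./2
    else ~~ padded C' y /\ pad_rank C' y = pad_rank C x)).
- exact: pad_linear.
- exact: pad_linear.
- move=> x; have [Cx|Cx] := boolP (padded C x).
    exists (f x./2).*2.+1; rewrite padded_odd CC' /= uphalf_double; split=> //.
    by case/andP: Cx.
  by have [y Cy ey] := pad_rank_surj C' (pad_rank C x); exists y.
- move=> y; have [Cy|Cy] := boolP (padded C' y).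
    have [n _ en] : range f y./2 by apply: fC'; case/andP: Cy.
    exists n.*2.+1; rewrite padded_odd -CC' en /= uphalf_double.
    by have /andP[_ ->] := Cy.
  have [x Cx ex] := pad_rank_surj C (pad_rank C' y); exists x.
  by rewrite (negbTE Cx).
- move=> x y x' y'; rewrite /pad.
  case: (boolP (padded C x)) => Cx [Cx' ex];
    case: (boolP (padded C y)) => Cy [Cy' ey].
  + by rewrite Cx' Cy' ex ey fm.
  + by rewrite Cx' (negbTE Cy').
  + by rewrite (negbTE Cx') Cy'.
  + rewrite (negbTE Cx') (negbTE Cy') /= -(pad_rank_mono Cx') // ex ey.
    exact: pad_rank_mono.
Qed.

(** A point of the copy of [omega] has only finitely many points below it, whereas a padded point
    lies above all even numbers. *)
Lemma pad_iso_padded (r r' : rel nat) (C C' : pred nat) (f g : nat -> nat) :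
  cancel f g -> cancel g f ->
  {mono f : x y / pad r C x y >-> pad r' C' x y} ->
  forall x, padded C' (f x) -> padded C x.
Proof.
move=> fK gK fm x C'fx; apply: contraT => Cx.
have small n : g n.*2 <= x.
  have : pad r C (g n.*2) x by rewrite -fm gK /pad padded_double C'fx.
  by rewrite /pad (negbTE Cx); case: ifP.
(* Pigeonhole: [x.+2] distinct values would lie among the [x.+1] numbers up to [x]. *)
have : size [seq g n.*2 | n <- iota 0 x.+2] <= size (iota 0 x.+1).
  apply: uniq_leq_size.
    by rewrite map_inj_uniq ?iota_uniq // => n m /(can_inj gK) /double_inj.
  by move=> _ /mapP[n _ ->]; rewrite mem_iota ltnS small.
by rewrite size_map !size_iota ltnn.
Qed.

(** On [C], [f] reads the given isomorphism through the coding [n.*2.+1]; its values off [C] carry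
    no meaning. *)
Lemma pad_iso_inv (r r' : rel nat) (C C' : pred nat) :
  order_iso (pad r C) (pad r' C') -> exists f : nat -> nat,
  [/\ forall n, C n -> C' (f n),
      forall n m, C n -> C m -> r' (f n) (f m) = r n m &
      forall m, C' m -> exists2 n, C n & f n = m].
Proof.
move=> [f [g fK gK] fm].
have gm : {mono g : x y / pad r' C' x y >-> pad r C x y}.
  by move=> x y; rewrite -fm !gK.
have Cf x : padded C' (f x) = padded C x.
  apply/idP/idP; first exact: (pad_iso_padded fK gK fm).
  by rewrite -{1}[x]fK; exact: (pad_iso_padded gK fK gm).
have fP n : C n -> padded C' (f n.*2.+1) by rewrite Cf padded_odd.
exists (fun n => (f n.*2.+1)./2); split.
- by move=> n /fP /andP[].
- move=> n m Cn Cm; have := fm n.*2.+1 m.*2.+1.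
  by rewrite /pad !fP // !padded_odd Cn Cm /= !uphalf_double.
- move=> m C'm; have Cg : padded C (g m.*2.+1) by rewrite -Cf gK padded_odd.
  exists (g m.*2.+1)./2; first by case/andP: Cg.
  by rewrite -(paddedE Cg) gK /= uphalf_double.
Qed.

Section Intervals.

Variables ua ub : bool.

(* [ua] and [ub] tell whether the interval has the lower end [p.1], respectively
   the upper end [p.2]; otherwise it is unbounded on that side. *)
Definition interval (r : rel nat) (p : nat * nat) : pred nat :=
  fun n => (ua ==> r p.1 n) && (ub ==> r n p.2).

Lemma interval_convex (r : rel nat) p : linear_order r ->
  order_convex r [set n | interval r p n].
Proof.
move=> [_ _ rt _] x y z /andP[ax _] /andP[_ zb] xy yz; apply/andP; split.
  by apply/implyP => u; apply: rt xy; exact: (implyP ax).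
by apply/implyP => u; apply: rt yz _; exact: (implyP zb).
Qed.

(** Points of the target interval are values of [f]: by convexity when both ends exist, otherwise
    because the range of [f] is closed towards a missing end. *)
Lemma interval_pad_iso (r s : rel nat) (f : nat -> nat) p :
  linear_order r -> linear_order s ->
  {mono f : x y / r x y >-> s x y} -> order_convex s (range f) ->
  (~~ ua -> forall y z, s z (f y) -> range f z) ->
  (~~ ub -> forall y z, s (f y) z -> range f z) ->
  order_iso (pad r (interval r p)) (pad s (interval s (f p.1, f p.2))).
Proof.
move=> lr ls fm fc fdown fup; apply: (pad_iso (f := f)) => //.
  by move=> n; rewrite /interval /= !fm.
move=> m /andP[/= am mb].
have [_ _ _ sto] := ls.
have [u|u] := boolP ua; have [v|v] := boolP ub; rewrite ?u ?v /= in am mb.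
- by apply: fc am mb; [exists p.1|exists p.2].
- exact: fup v _ _ am.
- exact: fdown u _ _ mb.
- by have /orP[/(fdown u)|/(fup v)] := sto m (f p.1).
Qed.

Lemma embeds_in_interval (r : rel nat) : linear_order r ->
  (ua -> left_compressible r) -> (ub -> right_compressible r) ->
  exists (p : nat * nat) (h : nat -> nat),
    [/\ {mono h : x y / r x y}, order_convex r (range h) &
        forall x, interval r p (h x)].
Proof.
move=> lr lc rc; have [rr ra rt rto] := lr.
have [hl [a [lm lcv la]]] : exists hl a, [/\ {mono hl : x y / r x y},
    order_convex r (range hl) & ua -> forall x, r a (hl x)].
  (* Without a lower end, the identity works and [a] is arbitrary. *)
  have [u|_] := boolP ua; last by exists id, 0; split=> // x y z *; exists y.
  have /(left_compressibleP lr)[h [a [hm hi ha]]] := lc u.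
  exists h, a; split=> [x y|x y z [x' _ <-] _ xy _|_ x]; first exact: hm.
    exact: hi xy.
  by have /orP[//|/hi] := rto a (h x).
have [hr [b [rm rcv rb]]] : exists hr b, [/\ {mono hr : x y / r x y},
    order_convex r (range hr) & ub -> forall x, r (hr x) b].
  have [u|_] := boolP ub; last by exists id, 0; split=> // x y z *; exists y.
  have /(right_compressibleP lr)[h [b [hm hi hb]]] := rc u.
  exists h, b; split=> [x y|x y z _ [z' _ <-] _ yz|_ x]; first exact: hm.
    exact: hi yz.
  by have /orP[//|/hi] := rto (h x) b.
have [hm hc] := convex_embedding_comp rm rcv lm lcv.
(* All values of [hl] are above [a], and [hr] stays below [b], hence the upper end [hl b]. *)
exists (a, hl b), (hl \o hr); split=> // x.
apply/andP; split; apply/implyP => u /=.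
  exact: la.
by rewrite lm; exact: rb.
Qed.

(** The embedding is [h] followed by the isomorphism between the two intervals; its range is convex
    since the target interval is. *)
Lemma interval_iso_embed (r s : rel nat) p q (h : nat -> nat) :
  linear_order s -> {mono h : x y / r x y} -> order_convex r (range h) ->
  (forall x, interval r p (h x)) ->
  order_iso (pad r (interval r p)) (pad s (interval s q)) ->
  convex_embeddable r s.
Proof.
move=> ls hm hc hp /pad_iso_inv[f [fq fm fsurj]].
exists (f \o h) => [x y|_ y _ [x _ <-] [z _ <-] xy yz]; first by rewrite /= fm.
have [n np fn] : exists2 n, interval r p n & f n = y.
  by apply: fsurj; apply: interval_convex (fq _ (hp x)) (fq _ (hp z)) xy yz.
move: xy yz; rewrite -fn /= !fm // => xn nz.
have [w _ hw] : range h n by apply: hc xn nz; [exists x|exists z].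
by exists w; rewrite //= hw.
Qed.

Definition interval_code (L : LO) (p : nat * nat) : LO :=
  LO_of (pad_linear (interval (LO_rel L) p) (LO_linear L)).

Lemma interval_code_continuous p : continuous (interval_code^~ p).
Proof.
apply: LO_continuous => n m L.
have nearI k :
    \forall K \near L, interval (LO_rel K) p k = interval (LO_rel L) p k.
  apply: filterS2 (LO_near L p.1 k) (LO_near L k p.2) => K.
  by rewrite /interval => -> ->.
apply: filterS3 (nearI n./2) (nearI m./2) (LO_near L n./2 m./2) => K.
by rewrite !LO_rel_of /pad /padded => -> -> ->.
Qed.

(** Indices that decode to nothing repeat [(0, 0)]; this is harmless, as the jump only sees the set
    of classes. *)
Definition nat_pair (i : nat) : nat * nat := odflt (0, 0) (unpickle i).

Definition interval_codes (L : LO) : sequences LO :=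
  fun i => interval_code L (nat_pair i).

Lemma interval_codes_borel : borel_map interval_codes.
Proof.
apply: borel_map_continuous => L.
have FF : Filter (interval_codes x @[x --> L]) by exact/fmap_filter/nbhs_filter.
by apply: cvg_prod_topology => i; exact: interval_code_continuous.
Qed.

Lemma interval_codesE L p : interval_codes L (pickle p) = interval_code L p.
Proof. by rewrite /interval_codes /nat_pair pickleK. Qed.

Lemma interval_code_biembed (L L' : LO) :
  (~~ ua -> ~ LO_l L') -> (~~ ub -> ~ LO_r L') -> LO_convex_biemb L L' ->
  forall p, exists q, LO_iso (interval_code L p) (interval_code L' q).
Proof.
move=> nl nr [[f fm fc] [g gm gc]] p; exists (f p.1, f p.2).
have [lL lL'] := (LO_linear L, LO_linear L').
rewrite /LO_iso !LO_rel_of; apply: interval_pad_iso => // [/nl|/nr] nc y z.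
  exact: (biembedding_downward lL' fm gm fc gc).
exact: (biembedding_upward lL' fm gm fc gc).
Qed.

(** [L] embeds convexly in one of its own intervals, and that interval is isomorphic to one of
    [L']. *)
Lemma interval_code_embed (L L' : LO) :
  (ua -> LO_l L) -> (ub -> LO_r L) ->
  (forall p, exists q, LO_iso (interval_code L p) (interval_code L' q)) ->
  LO_convex_le L L'.
Proof.
move=> lL rL LL'.
have [p [h [hm hc hp]]] := embeds_in_interval (LO_linear L) lL rL.
have [q] := LL' p; rewrite /LO_iso !LO_rel_of.
exact: interval_iso_embed (LO_linear L') hm hc hp.
Qed.

(** The flags give the intervals an end exactly on the sides where the orders in [A] are
    compressible. *)
Lemma interval_codes_reduction (A : set LO) :
  (forall L, A L -> LO_l L <-> ua) -> (forall L, A L -> LO_r L <-> ub) ->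
  borel_reducible LO_convex_biemb A (FS_jump LO_iso).
Proof.
move=> Al Ar; exists interval_codes; split; first exact: interval_codes_borel.
have nl L : A L -> ~~ ua -> ~ LO_l L by move=> /Al lL /negP nu /lL.
have nr L : A L -> ~~ ub -> ~ LO_r L by move=> /Ar rL /negP nu /rL.
have sym L L' : LO_iso L L' -> LO_iso L' L by exact: order_iso_sym.
move=> L L' AL AL'; rewrite FS_jump_LO_iso; split=> [LL'|[LL' L'L]].
  split=> [n|m].
    have [q ?] :=
      interval_code_biembed (nl _ AL') (nr _ AL') LL' (nat_pair n).
    by exists (pickle q); rewrite interval_codesE.
  have L'L : LO_convex_biemb L' L by case: LL'.
  have [p ?] := interval_code_biembed (nl _ AL) (nr _ AL) L'L (nat_pair m).
  by exists (pickle p); rewrite interval_codesE; exact: sym.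
split; apply: interval_code_embed => [/Al|/Ar|p]; try exact.
  by have [m] := LL' (pickle p); rewrite interval_codesE; exists (nat_pair m).
have [n] := L'L (pickle p); rewrite interval_codesE.
by exists (nat_pair n); exact: sym.
Qed.

End Intervals.

(** * The four classes of linear orders *)

Theorem theorem3p19 :
  ((forall L L' : LO,
      ([set: LO] `\` (LO_r `|` LO_l)) L ->
      ([set: LO] `\` (LO_r `|` LO_l)) L' ->
      (LO_convex_biemb L L' <-> LO_iso L L')) /\
   borel_reduction LO_convex_biemb ([set: LO] `\` (LO_r `|` LO_l))
     LO_iso (fun L : LO => L)) /\
  [/\ borel_reducible LO_convex_biemb (LO_r `&` LO_l) (FS_jump LO_iso)
        /\ borel_reducible LO_convex_biemb (LO_r `&` LO_l) LO_iso,
      borel_reducible LO_convex_biemb (LO_l `\` LO_r) (FS_jump LO_iso)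
        /\ borel_reducible LO_convex_biemb (LO_l `\` LO_r) LO_iso
    & borel_reducible LO_convex_biemb (LO_r `\` LO_l) (FS_jump LO_iso)
        /\ borel_reducible LO_convex_biemb (LO_r `\` LO_l) LO_iso].
Proof.
have FS A : borel_reducible LO_convex_biemb A (FS_jump LO_iso) ->
    borel_reducible LO_convex_biemb A (FS_jump LO_iso) /\
    borel_reducible LO_convex_biemb A LO_iso.
  by move=> redA; split=> //; exact: borel_reducible_comp FS_jump_reducible.
split; [split; [exact: LO_incompressible_biembP|split]|split; apply: FS].
- by [].
- exact: LO_incompressible_biembP.
- by apply: (@interval_codes_reduction true true) => L [].
- by apply: (@interval_codes_reduction true false) => L [].
- by apply: (@interval_codes_reduction false true) => L [].
Qed.
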